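(* Let $T>0$ and let $\theta,\eta:[0,T]\to(0,\infty)$ be continuously differentiable. Assume the permanent impact $\theta$ is strictly increasing and the temporary impact $\eta$ is strictly decreasing, and assume moreover that (for each $Q>0$) the Optimal Execution Problem of maximizing $\mathcal{J}$ over $\Xi(Q)$ has a unique solution. Then the optimal solution $\zeta$ is monotone (it involves only sell trades, i.e. $\dot\zeta_t\le0$ for all $t\in[0,T]$), so there is no transaction-triggered price manipulation, and hence no price manipulation.
   Context: $\Xi(Q)=\{\zeta\in\mathcal{C}^2([0,T]):\ \zeta_0=Q,\ \zeta_T=0\}$ and $$\mathcal{J}(\zeta)=\int_0^T\left(\theta_t\,\dot\zeta_t\,\zeta_t-\eta_t\,\dot\zeta_t^2\right)dt ,$$ which is the expected cash in excess of the initial mark-to-market value (minus the expected transaction cost). The model admits transaction-triggered price manipulation if there exist $Q>0$ and $\tilde\zeta\in\Xi(Q)$ with $\mathcal{J}(\tilde\zeta)>\sup\{\mathcal{J}(\zeta):\ \zeta\in\Xi(Q),\ \dot\zeta_t\le0\ \forall t\in[0,T]\}$. Price manipulation means that there exist $Q>0$ and $\zeta\in\Xi(Q)$ with negative expected transaction cost, i.e. $\mathcal{J}(\zeta)>0$. *)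

(* Defs.v *)
From Stdlib Require Import Reals Lra.
From Coquelicot Require Import Coquelicot.

Open Scope R_scope.

(* A function on [0,T] is represented by a total function R -> R.  Only its
   values on [0,T] matter in the definitions below: derivatives and continuity
   are taken relative to [0,T], hence are one-sided at the endpoints. *)
Definition horizon (T : R) (t : R) : Prop := 0 <= t <= T.

Definition ex_derive_on (D : R -> Prop) (f : R -> R) (x : R) : Prop :=
  exists l : R, D_in f (fun _ => l) D x.

(* Meaningful only where [ex_derive_on] holds and x is an accumulation point of
   D; see [Derive_on_unique]. *)
Definition Derive_on (D : R -> Prop) (f : R -> R) (x : R) : R :=
  iota (fun l : R => D_in f (fun _ => l) D x).

Definition C1_on (D : R -> Prop) (f : R -> R) : Prop :=
  (forall x, D x -> ex_derive_on D f x) /\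
  (forall x, D x -> continue_in (Derive_on D f) D x).

Definition C2_on (D : R -> Prop) (f : R -> R) : Prop :=
  C1_on D f /\ C1_on D (Derive_on D f).

Lemma Derive_on_unique (T : R) (f : R -> R) (x l : R) :
  0 < T -> horizon T x ->
  D_in f (fun _ => l) (horizon T) x -> Derive_on (horizon T) f x = l.
Proof.
intros hT hx hl; unfold Derive_on.
apply (iota_unique (V := R_CompleteNormedModule)); [|exact hl].
intros m hm.
refine (single_limit _ _ _ _ _ _ hm hl).
intros e he; unfold D_x, horizon, Rdist in *.
set (d := Rmin (e / 2) (T / 2)).
assert (hd : 0 < d) by (apply Rmin_glb_lt; lra).
assert (hde : d <= e / 2) by apply Rmin_l.
assert (hdT : d <= T / 2) by apply Rmin_r.
destruct (Rle_dec x (T / 2)).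
- exists (x + d); split; [split; lra|].
  replace (x + d - x) with d by ring; rewrite Rabs_pos_eq; lra.
- exists (x - d); split; [split; lra|].
  replace (x - d - x) with (- d) by ring; rewrite Rabs_Ropp, Rabs_pos_eq; lra.
Qed.

Definition Xi (T Q : R) (zeta : R -> R) : Prop :=
  C2_on (horizon T) zeta /\ zeta 0 = Q /\ zeta T = 0.

Definition J (theta eta : R -> R) (T : R) (zeta : R -> R) : R :=
  RInt (fun t => theta t * Derive_on (horizon T) zeta t * zeta t
                 - eta t * (Derive_on (horizon T) zeta t) ^ 2) 0 T.

Definition sell_only (T : R) (zeta : R -> R) : Prop :=
  forall t, horizon T t -> Derive_on (horizon T) zeta t <= 0.

Definition optimal_execution (theta eta : R -> R) (T Q : R) (zeta : R -> R)
  : Prop :=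
  Xi T Q zeta /\
  forall xi, Xi T Q xi -> J theta eta T xi <= J theta eta T zeta.

(* Uniqueness is equality of functions on [0,T]. *)
Definition unique_optimal_execution (theta eta : R -> R) (T Q : R) : Prop :=
  exists zeta, optimal_execution theta eta T Q zeta /\
    forall xi, optimal_execution theta eta T Q xi ->
      forall t, horizon T t -> xi t = zeta t.

(* The supremum is taken in the extended reals. *)
Definition transaction_triggered_price_manipulation
  (theta eta : R -> R) (T : R) : Prop :=
  exists Q zeta', 0 < Q /\ Xi T Q zeta' /\
    Rbar_lt
      (Lub_Rbar (fun x => exists zeta,
         Xi T Q zeta /\ sell_only T zeta /\ x = J theta eta T zeta))
      (Finite (J theta eta T zeta')).

Definition price_manipulation (theta eta : R -> R) (T : R) : Prop :=
  exists Q zeta, 0 < Q /\ Xi T Q zeta /\ 0 < J theta eta T zeta.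

(* Main.v *)
Require Import Defs.
From Stdlib Require Import Reals Lra.
From Coquelicot Require Import Coquelicot.

Open Scope R_scope.

(** Since [(theta zeta^2 / 2)' = theta' zeta^2 / 2 + theta zeta zeta'] and
    [theta' >= 0], the integrand of J is at most the derivative of
    [theta zeta^2 / 2], so [J zeta <= - theta 0 Q^2 / 2 < 0].  A maximizer
    satisfies the Euler-Lagrange equation [2 (eta zeta')' = theta' zeta].
    Multiplied by [zeta] it gives [(eta zeta zeta')' >= 0], so [zeta] vanishes
    on [a,T] as soon as [zeta a = 0]; hence [zeta >= 0].  Then [eta zeta'] is
    nondecreasing, and if it were positive somewhere [zeta] would increase from
    there to [zeta T = 0], which is impossible. *)

(** * Calculus rules for real functions *)

Lemma continuous_Rplus (f g : R -> R) (x : R) :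
  continuous f x -> continuous g x -> continuous (fun t => f t + g t) x.
Proof. exact (continuous_plus f g x). Qed.

Lemma continuous_Rminus (f g : R -> R) (x : R) :
  continuous f x -> continuous g x -> continuous (fun t => f t - g t) x.
Proof. exact (continuous_minus f g x). Qed.

Lemma continuous_Rmult (f g : R -> R) (x : R) :
  continuous f x -> continuous g x -> continuous (fun t => f t * g t) x.
Proof. exact (continuous_mult f g x). Qed.

Lemma continuous_sqr (f : R -> R) (x : R) :
  continuous f x -> continuous (fun t => f t ^ 2) x.
Proof.
intros hf; simpl.
apply continuous_Rmult; [exact hf|].
apply continuous_Rmult; [exact hf|apply continuous_const].
Qed.

(* Dispatching on syntax: plain unification would unfold [RInt]. *)
Ltac continuity_R :=
  repeat match goal with
    | |- continuous (fun t => _ - _) _ => apply continuous_Rminus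
    | |- continuous (fun t => _ + _) _ => apply continuous_Rplus
    | |- continuous (fun t => _ * _) _ => apply continuous_Rmult
    | |- continuous (fun t => _ ^ 2) _ => apply continuous_sqr
    | |- continuous (fun t => ?c) _ => apply continuous_const
    end; auto.

Lemma is_derive_Rmult (f g : R -> R) (x df dg : R) :
  is_derive f x df -> is_derive g x dg ->
  is_derive (fun t => f t * g t) x (df * g x + f x * dg).
Proof.
intros hf hg; exact (is_derive_mult f g x df dg hf hg Rmult_comm).
Qed.

Lemma is_derive_Rplus (f g : R -> R) (x df dg : R) :
  is_derive f x df -> is_derive g x dg ->
  is_derive (fun t => f t + g t) x (df + dg).
Proof. exact (is_derive_plus f g x df dg). Qed.

Lemma is_derive_Rminus (f g : R -> R) (x df dg : R) :
  is_derive f x df -> is_derive g x dg ->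
  is_derive (fun t => f t - g t) x (df - dg).
Proof. exact (is_derive_minus f g x df dg). Qed.

Lemma is_derive_continuous (f : R -> R) (x l : R) :
  is_derive f x l -> continuous f x.
Proof. intros h; apply (ex_derive_continuous f); exists l; exact h. Qed.

Lemma is_derive_eq (f : R -> R) (x l m : R) :
  is_derive f x l -> l = m -> is_derive f x m.
Proof. intros h <-; exact h. Qed.

(** The derivative is carried as an explicit function on the whole line, so that two-sided
    derivatives and integrals apply without endpoint cases. *)
Definition C1_pair (f f' : R -> R) : Prop :=
  (forall x, is_derive f x (f' x)) /\ (forall x, continuous f' x).

Lemma C1_pair_continuous (f f' : R -> R) :
  C1_pair f f' -> forall x, continuous f x.
Proof. intros [h _] x; exact (is_derive_continuous _ _ _ (h x)). Qed.

Lemma continuous_ex_RInt (f : R -> R) (a b : R) :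
  (forall x, continuous f x) -> ex_RInt f a b.
Proof. intros h; apply (ex_RInt_continuous f); intros; apply h. Qed.

Lemma C1_pair_RInt (c : R) (g : R -> R) :
  (forall x, continuous g x) -> C1_pair (fun t => c + RInt g 0 t) g.
Proof.
intros h; split; [intros x|exact h].
apply is_derive_eq with (0 + g x); [|ring].
apply is_derive_Rplus; [exact (is_derive_const c x)|].
apply (is_derive_RInt g (fun t => RInt g 0 t) 0 x); [|apply h].
apply filter_forall; intros y; apply (RInt_correct g).
now apply continuous_ex_RInt.
Qed.

Lemma C1_pair_const (c : R) : C1_pair (fun _ => c) (fun _ => 0).
Proof.
split; intros x; [exact (is_derive_const c x)|apply continuous_const].
Qed.

Lemma C1_pair_plus (f f' g g' : R -> R) :
  C1_pair f f' -> C1_pair g g' ->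
  C1_pair (fun t => f t + g t) (fun t => f' t + g' t).
Proof.
intros [hf cf] [hg cg]; split; intros x;
  [now apply is_derive_Rplus|continuity_R].
Qed.

Lemma C1_pair_minus (f f' g g' : R -> R) :
  C1_pair f f' -> C1_pair g g' ->
  C1_pair (fun t => f t - g t) (fun t => f' t - g' t).
Proof.
intros [hf cf] [hg cg]; split; intros x;
  [now apply is_derive_Rminus|continuity_R].
Qed.

Lemma C1_pair_mult (f f' g g' : R -> R) :
  C1_pair f f' -> C1_pair g g' ->
  C1_pair (fun t => f t * g t) (fun t => f' t * g t + f t * g' t).
Proof.
intros hf hg.
pose proof (C1_pair_continuous _ _ hf) as cf.
pose proof (C1_pair_continuous _ _ hg) as cg.
destruct hf as [hf cf'], hg as [hg cg']; split; intros x;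
  [now apply is_derive_Rmult|continuity_R].
Qed.

Lemma C1_pair_scal (c : R) (f f' : R -> R) :
  C1_pair f f' -> C1_pair (fun t => c * f t) (fun t => c * f' t).
Proof.
intros [hf cf]; split; intros x; [|continuity_R].
exact (is_derive_scal f x c (f' x) (hf x)).
Qed.

Lemma RInt_C1_pair (f f' : R -> R) (a b : R) :
  C1_pair f f' -> RInt f' a b = f b - f a.
Proof.
intros [hf cf].
apply (is_RInt_unique f'), (is_RInt_derive f f'); intros; auto.
Qed.

(** * Monotonicity and the sign of the derivative *)

Lemma nondecreasing_of_derive (f f' : R -> R) (a b : R) :
  (forall x, is_derive f x (f' x)) -> (forall x, a < x < b -> 0 <= f' x) ->
  forall s t, a <= s -> s <= t -> t <= b -> f s <= f t.
Proof.
intros hf pos s t has hst htb.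
destruct hst as [hst| ->]; [|apply Rle_refl].
destruct (MVT_cor2 f f' s t hst) as [c [e hc]].
{ intros c _; apply is_derive_Reals, hf. }
assert (0 <= f' c * (t - s)) by (apply Rmult_le_pos; [apply pos|]; lra).
lra.
Qed.

Lemma locally_open_interval (a b x : R) :
  a < x < b -> locally x (fun t => a < t < b).
Proof.
intros [h1 h2].
exact (locally_interval _ x (Finite a) (Finite b) h1 h2
  (fun t h h' => conj h h')).
Qed.

Lemma derive_zero_of_const (f : R -> R) (a b c x l : R) :
  a < x < b -> (forall t, a < t < b -> f t = c) -> is_derive f x l -> l = 0.
Proof.
intros hx hc hf.
rewrite <- (is_derive_unique f x l hf).
apply is_derive_unique, (is_derive_ext_loc (fun _ => c));
  [|exact (is_derive_const c x)].
apply (filter_imp (fun t => a < t < b)); [|now apply locally_open_interval].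
intros t ht; symmetry; now apply hc.
Qed.

(** Being nondecreasing, [f] is squeezed between its equal end values, hence constant on the
    interval. *)
Lemma derive_zero_of_equal_ends (f f' : R -> R) (a b : R) :
  (forall x, is_derive f x (f' x)) -> (forall x, a < x < b -> 0 <= f' x) ->
  f a = f b -> forall x, a < x < b -> f' x = 0.
Proof.
intros hf pos eab x hx.
apply (derive_zero_of_const f a b (f a) x); auto.
intros t ht.
pose proof (nondecreasing_of_derive f f' a b hf pos a t).
pose proof (nondecreasing_of_derive f f' a b hf pos t b).
lra.
Qed.

Lemma continuous_neg_locally (f : R -> R) (x : R) :
  continuous f x -> f x < 0 -> locally x (fun t => f t < 0).
Proof.
intros hc hn; apply (hc (fun y => y < 0)).
exact (open_lt 0 (f x) hn).
Qed.

(** If [f' x] were negative, continuity would keep [f'] negative on a short interval to the right of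
    [x], and the mean value theorem would make [f] decrease there. *)
Lemma derive_nonneg_of_increasing (f f' : R -> R) (a b x : R) :
  C1_pair f f' -> (forall s t, a < s -> s < t -> t < b -> f s < f t) ->
  a < x < b -> 0 <= f' x.
Proof.
intros [hf cf] incr hx.
destruct (Rle_lt_dec 0 (f' x)) as [h|h]; [exact h|exfalso].
destruct (filter_and _ _ (continuous_neg_locally f' x (cf x) h)
  (locally_open_interval a b x hx)) as [d hd].
assert (hd0 := cond_pos d).
assert (near : forall y, x <= y <= x + d / 2 -> f' y < 0 /\ a < y < b).
{ intros y hy; apply hd.
  unfold ball; simpl; unfold AbsRing_ball, abs, minus, plus, opp; simpl.
  rewrite Rabs_pos_eq; lra. }
destruct (MVT_cor2 f f' x (x + d / 2)) as [c [e hc]]; [lra| |].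
{ intros c _; apply is_derive_Reals, hf. }
assert (f x < f (x + d / 2)).
{ apply incr; [lra|lra|]. apply near; lra. }
assert (f' c < 0) by (apply near; lra).
assert (0 < - f' c * (x + d / 2 - x)) by (apply Rmult_lt_0_compat; lra).
lra.
Qed.

(** For small [eps] of the sign of [l], the linear term would outweigh the quadratic one and make
    the sum positive. *)
Lemma linear_coefficient_zero (l k : R) :
  (forall eps, eps * l + eps ^ 2 * k <= 0) -> l = 0.
Proof.
intros h.
set (m := 1 + Rabs k).
assert (hk := Rle_abs (- k)). rewrite Rabs_Ropp in hk.
assert (hm : 0 < m) by (unfold m; pose proof (Rabs_pos k); lra).
(* Since [l = (l / m) * m], this [eps] turns the sum into [(l / m) ^ 2 * (m + k)], and [m + k >= 1]
   by the choice of [m]. *)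
specialize (h (l / m)).
assert (e : l / m * l + (l / m) ^ 2 * k = (l / m) ^ 2 * (m + k))
  by (field; lra).
rewrite e in h.
destruct (Req_dec l 0) as [h0|h0]; [exact h0|exfalso].
assert (l / m <> 0).
{ intros q; apply h0; replace l with (l / m * m) by (field; lra).
  rewrite q; ring. }
assert (0 < (l / m) ^ 2) by (now apply pow2_gt_0).
assert (0 < (l / m) ^ 2 * (m + k))
  by (apply Rmult_lt_0_compat; unfold m in *; lra).
lra.
Qed.

(** * The variational problem with coefficients defined on the whole line *)

Definition revenue_rate (th et z z' : R -> R) (t : R) : R :=
  th t * z' t * z t - et t * z' t ^ 2.

Section GlobalProblem.

Variables (T : R) (th th' et et' : R -> R).
Hypotheses (hT : 0 < T) (hth : C1_pair th th') (het : C1_pair et et').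
Hypothesis th'_nonneg : forall t, 0 < t < T -> 0 <= th' t.
Hypothesis et_pos : forall t, 0 <= t <= T -> 0 < et t.

Local Lemma th_continuous t : continuous th t.
Proof. now apply (C1_pair_continuous th th'). Qed.

Local Lemma et_continuous t : continuous et t.
Proof. now apply (C1_pair_continuous et et'). Qed.

Local Hint Resolve th_continuous et_continuous : core.

Lemma continuous_revenue_rate (z z' : R -> R) :
  (forall t, continuous z t) -> (forall t, continuous z' t) ->
  forall t, continuous (revenue_rate th et z z') t.
Proof. intros hz hz' t; unfold revenue_rate; continuity_R. Qed.

(* The integrand is [(th z^2 / 2)' - th' z^2 / 2 - et z'^2]. *)
Lemma revenue_upper_bound (z z' : R -> R) :
  C1_pair z z' -> z T = 0 ->
  RInt (revenue_rate th et z z') 0 T <= - (th 0 * z 0 ^ 2) / 2.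
Proof.
intros hz zT.
pose proof (C1_pair_continuous _ _ hz) as cz.
pose proof (C1_pair_mult _ _ _ _ hth (C1_pair_mult _ _ _ _ hz hz)) as hP.
apply (C1_pair_scal (/ 2)) in hP.
pose proof (RInt_C1_pair _ _ 0 T hP) as e; cbv beta in e.
rewrite zT in e.
replace (- (th 0 * z 0 ^ 2) / 2) with
  (/ 2 * (th T * (0 * 0)) - / 2 * (th 0 * (z 0 * z 0))) by field.
rewrite <- e.
apply RInt_le; [lra| | |].
- apply continuous_ex_RInt, continuous_revenue_rate; [exact cz|apply hz].
- apply continuous_ex_RInt, hP.
- intros t ht; unfold revenue_rate.
  assert (0 <= th' t * z t ^ 2)
    by (apply Rmult_le_pos; [now apply th'_nonneg|apply pow2_ge_0]).
  assert (0 <= et t * z' t ^ 2)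
    by (apply Rmult_le_pos; [apply Rlt_le, et_pos; lra|apply pow2_ge_0]).
  lra.
Qed.

(** * First variation and the Euler-Lagrange equation *)

Variables z z' z'' : R -> R.
Hypotheses (hz : C1_pair z z') (hz' : C1_pair z' z'') (zT : z T = 0).

Definition optimal_among_C2_perturbations : Prop :=
  forall h h' h'' : R -> R, C1_pair h h' -> C1_pair h' h'' ->
  h 0 = 0 -> h T = 0 -> forall eps : R,
  RInt (revenue_rate th et (fun t => z t + eps * h t)
          (fun t => z' t + eps * h' t)) 0 T
  <= RInt (revenue_rate th et z z') 0 T.

Hypothesis hopt : optimal_among_C2_perturbations.

Local Lemma z_continuous t : continuous z t.
Proof. now apply (C1_pair_continuous z z'). Qed.

Local Lemma z'_continuous t : continuous z' t.
Proof. now apply (C1_pair_continuous z' z''). Qed.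

Local Hint Resolve z_continuous z'_continuous : core.

(** The functional is quadratic, so its expansion along [z + eps h] is exact: the value at [z], plus
    [eps] times this integral, plus [eps ^ 2] times the value at [h]. Optimality makes the last two
    terms together nonpositive for every [eps]. *)
Lemma first_variation_zero (h h' h'' : R -> R) :
  C1_pair h h' -> C1_pair h' h'' -> h 0 = 0 -> h T = 0 ->
  RInt (fun t => th t * z' t * h t + th t * z t * h' t
                 - 2 * et t * z' t * h' t) 0 T = 0.
Proof.
intros hh hh' h0 hT0.
pose proof (C1_pair_continuous _ _ hh) as ch.
pose proof (C1_pair_continuous _ _ hh') as ch'.
set (L := fun t => th t * z' t * h t + th t * z t * h' t
                   - 2 * et t * z' t * h' t).
assert (cL : forall t, continuous L t).
{ intros t; unfold L; continuity_R. }
apply (linear_coefficient_zero _ (RInt (revenue_rate th et h h') 0 T)).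
intros eps.
pose proof (hopt h h' h'' hh hh' h0 hT0 eps) as le.
assert (cI : forall t, continuous (revenue_rate th et z z') t)
  by (apply continuous_revenue_rate; auto).
assert (cK : forall t, continuous (revenue_rate th et h h') t)
  by (apply continuous_revenue_rate; auto).
enough (e : RInt (revenue_rate th et (fun t => z t + eps * h t)
          (fun t => z' t + eps * h' t)) 0 T
   = RInt (revenue_rate th et z z') 0 T
     + (eps * RInt L 0 T + eps ^ 2 * RInt (revenue_rate th et h h') 0 T))
  by lra.
apply (is_RInt_unique (V := R_CompleteNormedModule)).
apply (is_RInt_ext (fun t => revenue_rate th et z z' t
   + (eps * L t + eps ^ 2 * revenue_rate th et h h' t))).
{ intros t _; unfold revenue_rate, L; simpl; ring. }
apply (is_RInt_plus (V := R_NormedModule)).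
{ apply (RInt_correct (V := R_CompleteNormedModule)).
  now apply continuous_ex_RInt. }
apply (is_RInt_plus (V := R_NormedModule));
  apply (is_RInt_scal (V := R_NormedModule));
  apply (RInt_correct (V := R_CompleteNormedModule));
  now apply continuous_ex_RInt.
Qed.

(* Integrating [th z' h] by parts turns the first variation into the integral
   of [G h'] with [G = th z - 2 et z' - int th z']; the test function
   with [h' = G - mean of G] is C2 and forces [G] to be constant (du
   Bois-Reymond). *)
Lemma euler_lagrange (t : R) :
  0 < t < T -> 2 * (et' t * z' t + et t * z'' t) = th' t * z t.
Proof.
set (P := fun t => 0 + RInt (fun s => th s * z' s) 0 t).
assert (hP : C1_pair P (fun s => th s * z' s)).
{ apply C1_pair_RInt; intros s; continuity_R. }
pose proof (C1_pair_minus _ _ _ _ (C1_pair_minus _ _ _ _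
   (C1_pair_mult _ _ _ _ hth hz)
   (C1_pair_scal 2 _ _ (C1_pair_mult _ _ _ _ het hz'))) hP) as hG.
cbv beta in hG.
set (G := fun x => th x * z x - 2 * (et x * z' x) - P x) in hG.
pose proof (C1_pair_continuous _ _ hG) as cG.
(* The mean of [G], which makes the primitive [h] of [G - c] vanish at [T]. *)
set (c := RInt G 0 T / T).
pose proof (C1_pair_minus _ _ _ _ hG (C1_pair_const c)) as hh'.
cbv beta in hh'.
set (h' := fun x => G x - c) in hh'.
set (h := fun x => 0 + RInt h' 0 x).
assert (ch' : forall x, continuous h' x) by exact (C1_pair_continuous _ _ hh').
assert (hh : C1_pair h h') by now apply C1_pair_RInt.
assert (h0 : h 0 = 0).
{ unfold h; rewrite (RInt_point (V := R_CompleteNormedModule)).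
  unfold zero; simpl; ring. }
assert (hT0 : h T = 0).
{ unfold h, h'.
  pose proof (RInt_minus (V := R_CompleteNormedModule) G (fun _ => c) 0 T
    (continuous_ex_RInt _ _ _ cG)
    (continuous_ex_RInt _ _ _ (fun x => continuous_const c x))) as e.
  rewrite (RInt_const (V := R_CompleteNormedModule)) in e.
  unfold minus, plus, opp, scal in e; simpl in e; unfold mult in e; simpl in e.
  unfold Rminus; rewrite e; unfold c; field; lra. }
pose proof (first_variation_zero h h' _ hh hh' h0 hT0) as V.
pose proof (C1_pair_continuous _ _ hh) as ch.
pose proof (C1_pair_continuous _ _ hP) as cP.
(* The function [P h + c h] vanishes at both ends. Subtracting its derivative from the integrand of
   the first variation leaves [(G - c) h'], which is [h' ^ 2]. *)
pose proof (C1_pair_plus _ _ _ _ (C1_pair_mult _ _ _ _ hP hh)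
  (C1_pair_scal c _ _ hh)) as hB.
assert (V2 : RInt (fun x => h' x * h' x) 0 T = 0).
{ pose proof (RInt_C1_pair _ _ 0 T hB) as e; cbv beta in e.
  rewrite h0, hT0 in e.
  match type of e with RInt ?B _ _ = _ =>
  match type of V with RInt ?L _ _ = _ =>
    assert (d := RInt_minus (V := R_CompleteNormedModule) L B 0 T)
  end end.
  rewrite V, e in d.
  refine (eq_trans _ (eq_trans (d _ _) _)).
  - apply (RInt_ext (V := R_CompleteNormedModule)); intros x _.
    unfold minus, plus, opp, h', G; simpl; ring.
  - apply continuous_ex_RInt; intros x; continuity_R.
  - apply continuous_ex_RInt, hB.
  - unfold minus, plus, opp; simpl; ring. }
assert (h'0 : forall x, 0 < x < T -> h' x = 0).
{ intros x hx.
  (* The primitive of [h' ^ 2] takes equal values at [0] and [T], so its nonnegative derivative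
     vanishes in between. *)
  assert (hS : C1_pair (fun x => 0 + RInt (fun x => h' x * h' x) 0 x)
                 (fun x => h' x * h' x))
    by (apply C1_pair_RInt; intros y; continuity_R).
  apply Rsqr_0_uniq; unfold Rsqr.
  apply (derive_zero_of_equal_ends _ _ 0 T (proj1 hS)); [| |exact hx].
  - intros y _; apply Rle_0_sqr.
  - rewrite V2, (RInt_point (V := R_CompleteNormedModule)).
    unfold zero; simpl; ring. }
intros ht.
(* In [G' = 0] the two terms [th z'], one from [th z] and one from [P], cancel, which leaves the
   equation. *)
pose proof (derive_zero_of_const h' 0 T 0 t _ ht h'0 (proj1 hh' t)) as d.
cbv beta in d; lra.
Qed.

(* [(et z z')' = et z'^2 + th' z^2 / 2] is nonnegative. *)
Lemma zero_propagates (a : R) :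
  0 <= a <= T -> z a = 0 -> forall t, a <= t <= T -> z t = 0.
Proof.
intros ha za t ht.
pose proof (C1_pair_mult _ _ _ _ hz (C1_pair_mult _ _ _ _ het hz')) as hE.
cbv beta in hE.
set (E' := fun x => z' x * (et x * z' x) + z x * (et' x * z' x + et x * z'' x))
  in hE.
assert (E'_eq : forall x, 0 < x < T ->
  E' x = et x * z' x ^ 2 + th' x * z x ^ 2 / 2).
{ intros x hx; unfold E'.
  replace (et' x * z' x + et x * z'' x) with (th' x * z x / 2)
    by (pose proof (euler_lagrange x hx); lra).
  field. }
assert (pos : forall x, 0 < x < T ->
  0 <= et x * z' x ^ 2 /\ 0 <= th' x * z x ^ 2).
{ intros x hx; split; apply Rmult_le_pos; try apply pow2_ge_0.
  - apply Rlt_le, et_pos; lra.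
  - now apply th'_nonneg. }
assert (E0 : forall x, a < x < T -> E' x = 0).
{ apply (derive_zero_of_equal_ends _ _ a T (proj1 hE)).
  - intros x hx; rewrite E'_eq by lra; pose proof (pos x); lra.
  - rewrite za, zT; ring. }
assert (z'0 : forall x, a < x < T -> z' x = 0).
{ intros x hx.
  pose proof (E0 x hx) as e; rewrite E'_eq in e by lra.
  assert (hx' : 0 < x < T) by lra.
  destruct (pos x hx') as [p q].
  assert (e' : et x * z' x ^ 2 = 0) by lra.
  apply Rmult_integral in e'; destruct e' as [e'|e'].
  - pose proof (et_pos x); lra.
  - apply Rsqr_0_uniq; unfold Rsqr; lra. }
apply Rle_antisym; rewrite <- za.
- assert (- z a <= - z t); [|lra].
  apply (nondecreasing_of_derive (fun x => - z x) (fun x => - z' x) a T);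
    try lra.
  + intros x; exact (is_derive_opp z x (z' x) (proj1 hz x)).
  + intros x hx; rewrite z'0 by exact hx; lra.
- apply (nondecreasing_of_derive z z' a T (proj1 hz)); try lra.
  intros x hx; rewrite z'0 by exact hx; lra.
Qed.

(** * Sign and monotonicity of the maximizer *)

Hypothesis z0_pos : 0 < z 0.

(** A negative value at [t] forces a zero in [[0,t]], after which [z] stays zero, also at [t]. *)
Lemma optimal_nonneg (t : R) : 0 <= t <= T -> 0 <= z t.
Proof.
intros ht; destruct (Rle_lt_dec 0 (z t)) as [h|h]; [exact h|exfalso].
destruct (IVT_cor z 0 t) as [a [ha za]]; [|lra| |].
- intros x; apply continuity_pt_filterlim, z_continuous.
- rewrite Rmult_comm; apply Rlt_le.
  assert (0 < - z t * z 0) by (apply Rmult_lt_0_compat; lra). lra.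
- rewrite (zero_propagates a) in h; lra.
Qed.

Lemma optimal_nonincreasing (t : R) : 0 <= t <= T -> z' t <= 0.
Proof.
(* The time [T] is left out because the argument needs an interval [[s,T]] of positive length on
   which [z] would increase to [0]. *)
assert (key : forall t, 0 <= t < T -> z' t <= 0).
{ intros s hs; destruct (Rle_lt_dec (z' s) 0) as [h|h]; [exact h|exfalso].
  assert (up : forall x, s <= x <= T -> 0 < z' x).
  { intros x hx.
    (* By the Euler-Lagrange equation the derivative of [et z'] is [th' z / 2], nonnegative since
       [z] is. *)
    assert (et s * z' s <= et x * z' x).
    { apply (nondecreasing_of_derive (fun x => et x * z' x) _ 0 T
        (proj1 (C1_pair_mult _ _ _ _ het hz'))); try lra.
      intros y hy; pose proof (euler_lagrange y hy) as e.
      assert (0 <= th' y * z y)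
        by (apply Rmult_le_pos; [now apply th'_nonneg|apply optimal_nonneg; lra]).
      lra. }
    assert (0 < et s * z' s)
      by (apply Rmult_lt_0_compat; [apply et_pos|]; lra).
    apply Rmult_lt_reg_l with (et x); [apply et_pos|]; lra. }
  destruct (MVT_cor2 z z' s T) as [c [e hc]]; [lra| |].
  { intros c _; apply is_derive_Reals, hz. }
  assert (0 < z' c * (T - s))
    by (apply Rmult_lt_0_compat; [apply up|]; lra).
  pose proof (optimal_nonneg s); lra. }
(* At [T] itself the sign follows from continuity of [z']. *)
intros ht; destruct (Rlt_le_dec t T) as [h|h]; [apply key; lra|].
replace t with T by lra.
destruct (Rle_lt_dec (z' T) 0) as [p|p]; [exact p|exfalso].
destruct (continuous_neg_locally (fun x => - z' x) T) as [d hd].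
- apply (continuous_opp z'), z'_continuous.
- lra.
- assert (hd0 := cond_pos d).
  (* This keeps [T - r] both in [[0,T)], where [key] applies, and within [d] of [T]. *)
  set (r := Rmin (d / 2) T).
  assert (r <= d / 2) by apply Rmin_l.
  assert (r <= T) by apply Rmin_r.
  assert (0 < r) by (apply Rmin_glb_lt; lra).
  assert (- z' (T - r) < 0).
  { apply hd.
    unfold ball; simpl; unfold AbsRing_ball, abs, minus, plus, opp; simpl.
    rewrite Rabs_left; lra. }
  pose proof (key (T - r)); lra.
Qed.

End GlobalProblem.

(** * Extension of functions from [[0,T]] to the real line *)

Section Extension.

Variable T : R.
Hypothesis hT : 0 < T.

(** The nearest-point projection onto [[0,T]]. Composition with it extends a function by its
    endpoint values. *)
Definition clamp (x : R) : R := Rmax 0 (Rmin x T).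

Lemma clamp_horizon (x : R) : horizon T (clamp x).
Proof.
unfold horizon, clamp, Rmax, Rmin; repeat destruct Rle_dec; lra.
Qed.

Lemma clamp_id (x : R) : horizon T x -> clamp x = x.
Proof.
unfold horizon, clamp, Rmax, Rmin; repeat destruct Rle_dec; lra.
Qed.

Lemma clamp_contract (x y : R) : Rabs (clamp y - clamp x) <= Rabs (y - x).
Proof.
unfold clamp, Rmax, Rmin, Rabs; repeat destruct Rle_dec;
  repeat destruct Rcase_abs; lra.
Qed.

Lemma continuous_clamp (g : R -> R) :
  (forall x, horizon T x -> continue_in g (horizon T) x) ->
  forall x, continuous (fun t => g (clamp t)) x.
Proof.
intros hg x; apply continuity_pt_filterlim.
intros e he.
destruct (hg (clamp x) (clamp_horizon x) e he) as [d [hd H]].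
exists d; split; [exact hd|].
intros y [_ hy]; simpl in *; unfold Rdist in *.
(* Relative continuity speaks only of points distinct from the base point, while [clamp] may send
   [y] to the same point as [x]. *)
destruct (Req_dec (clamp y) (clamp x)) as [q|q].
- rewrite q, Rminus_diag, Rabs_R0; exact he.
- apply H; split; [split; [apply clamp_horizon|exact (not_eq_sym q)]|].
  apply Rle_lt_trans with (2 := hy), clamp_contract.
Qed.

Lemma D_in_interior (f : R -> R) (x l : R) :
  0 < x < T -> D_in f (fun _ => l) (horizon T) x -> is_derive f x l.
Proof.
intros hx hf; apply is_derive_Reals.
intros e he; destruct (hf e he) as [d [hd H]].
(* Within this radius [x + k] remains in [[0,T]]. *)
assert (hr : 0 < Rmin d (Rmin x (T - x))) by (repeat apply Rmin_glb_lt; lra).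
exists (mkposreal _ hr); simpl; intros k k0 hk.
assert (m1 := Rmin_l d (Rmin x (T - x))).
assert (m2 := Rmin_r d (Rmin x (T - x))).
assert (m3 := Rmin_l x (T - x)).
assert (m4 := Rmin_r x (T - x)).
specialize (H (x + k)); simpl in H; unfold Rdist, D_x, horizon in H.
replace (x + k - x) with k in H by ring.
apply H; apply Rabs_def2 in hk; repeat split; try lra.
apply Rabs_def1; lra.
Qed.

Lemma is_derive_D_in (f g : R -> R) (x l : R) :
  horizon T x -> (forall t, horizon T t -> f t = g t) ->
  is_derive g x l -> D_in f (fun _ => l) (horizon T) x.
Proof.
intros hx efg hg e he; apply is_derive_Reals in hg.
destruct (hg e he) as [d H]; exists d; split; [apply cond_pos|].
intros y [[hy yx] hd]; simpl in *; unfold Rdist in *.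
specialize (H (y - x)); replace (x + (y - x)) with y in H by ring.
rewrite !efg by assumption; apply H; [lra|exact hd].
Qed.

Lemma Derive_on_spec (f : R -> R) (x : R) :
  horizon T x -> ex_derive_on (horizon T) f x ->
  D_in f (fun _ => Derive_on (horizon T) f x) (horizon T) x.
Proof. intros hx [l hl]; now rewrite (Derive_on_unique T f x l). Qed.

(** The extension is [f 0] plus the integral of [g] from [0]. It has the derivative of [f] on
    [(0,T)] and the same value at [0], so the two agree on [[0,T]]. *)
Lemma extension_of_derivative (f g : R -> R) :
  (forall x, horizon T x -> ex_derive_on (horizon T) f x) ->
  (forall x, continuous g x) ->
  (forall x, horizon T x -> g x = Derive_on (horizon T) f x) ->
  exists F, C1_pair F g /\ forall x, horizon T x -> F x = f x.
Proof.
intros hf cg eg.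
exists (fun t => f 0 + RInt g 0 t).
pose proof (C1_pair_RInt (f 0) g cg) as hF.
split; [exact hF|intros x hx].
set (F := fun t => f 0 + RInt g 0 t) in *.
change (F x = f x).
assert (F0 : F 0 = f 0).
{ unfold F; rewrite (RInt_point (V := R_CompleteNormedModule)).
  unfold zero; simpl; ring. }
assert (h0 : horizon T 0) by (unfold horizon; lra).
(* The mean value theorem wants two-sided continuity at the ends, where [f] is only continuous
   relative to [[0,T]]; hence [f] is composed with [clamp]. *)
destruct (MVT_gen (fun t => f (clamp t) - F t) 0 x (fun _ => 0))
  as [c [_ e]].
- rewrite Rmin_left, Rmax_right by (unfold horizon in hx; lra).
  intros y hy.
  assert (hy' : 0 < y < T) by (unfold horizon in hx; lra).
  assert (hy2 : horizon T y) by (unfold horizon; lra).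
  apply is_derive_eq with (g y - g y); [|ring].
  apply is_derive_Rminus; [|apply hF].
  apply (is_derive_ext_loc f).
  + apply (filter_imp (fun t => 0 < t < T));
      [|now apply locally_open_interval].
    intros t ht; rewrite clamp_id; [reflexivity|unfold horizon; lra].
  + rewrite eg by exact hy2; apply D_in_interior; [exact hy'|].
    now apply Derive_on_spec, hf.
- intros y _; apply continuity_pt_filterlim.
  change (continuous (fun t => f (clamp t) - F t) y).
  apply continuous_Rminus; [|exact (C1_pair_continuous _ _ hF y)].
  apply continuous_clamp; intros t ht.
  eapply (cont_deriv f (fun _ => Derive_on (horizon T) f t)).
  now apply Derive_on_spec, hf.
- rewrite !clamp_id in e by assumption; lra.
Qed.

Lemma C1_extension (f : R -> R) :
  C1_on (horizon T) f ->
  exists F F', C1_pair F F' /\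
    forall x, horizon T x -> F x = f x /\ F' x = Derive_on (horizon T) f x.
Proof.
intros [hf cf].
set (F' := fun t => Derive_on (horizon T) f (clamp t)).
assert (e : forall x, horizon T x -> F' x = Derive_on (horizon T) f x).
{ intros x hx; unfold F'; now rewrite clamp_id. }
destruct (extension_of_derivative f F' hf (continuous_clamp _ cf) e)
  as [F [hF eF]].
exists F, F'; auto.
Qed.

(** The derivative is extended first, as a C1 function, and then integrated, so that the extension
    of [f] has exactly that function as derivative. *)
Lemma C2_extension (f : R -> R) :
  C2_on (horizon T) f ->
  exists F F' F'', C1_pair F F' /\ C1_pair F' F'' /\
    forall x, horizon T x -> F x = f x /\ F' x = Derive_on (horizon T) f x.
Proof.
intros [[hf cf] hf'].
destruct (C1_extension _ hf') as [F' [F'' [hF' e]]].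
destruct (extension_of_derivative f F' hf (C1_pair_continuous _ _ hF'))
  as [F [hF eF]].
{ intros x hx; now apply e. }
exists F, F', F''; split; [exact hF|split; [exact hF'|]].
intros x hx; split; [now apply eF|now apply e].
Qed.

(** * Return to derivatives relative to [[0,T]] *)

Lemma Derive_on_C1_pair (f F F' : R -> R) :
  C1_pair F F' -> (forall x, horizon T x -> f x = F x) ->
  forall x, horizon T x -> Derive_on (horizon T) f x = F' x.
Proof.
intros [hF _] e x hx; apply Derive_on_unique; auto.
now apply is_derive_D_in with F.
Qed.

(** Agreement on [[0,T]] is the right assumption for second derivatives: there [f] is a [Derive_on],
    identified only on [[0,T]]. *)
Lemma C1_on_C1_pair (f F F' : R -> R) :
  C1_pair F F' -> (forall x, horizon T x -> f x = F x) ->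
  C1_on (horizon T) f.
Proof.
intros hF e; split; intros x hx.
- exists (F' x); apply is_derive_D_in with F; auto; apply hF.
- intros eps he.
  assert (c : continuity_pt F' x)
    by (apply continuity_pt_filterlim, hF).
  destruct (c eps he) as [d [hd H]]; exists d; split; [exact hd|].
  intros y [[hy yx] hyd].
  rewrite !(Derive_on_C1_pair f F F' hF e) by assumption.
  apply H; repeat split; auto.
Qed.

Lemma C2_on_C1_pair (F F' F'' : R -> R) :
  C1_pair F F' -> C1_pair F' F'' -> C2_on (horizon T) F.
Proof.
intros hF hF'; split.
- exact (C1_on_C1_pair F F F' hF (fun _ _ => eq_refl)).
- apply (C1_on_C1_pair _ F' F'' hF').
  exact (Derive_on_C1_pair F F F' hF (fun _ _ => eq_refl)).
Qed.

Lemma J_extension (theta eta th et f F F' : R -> R) :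
  (forall x, horizon T x -> th x = theta x) ->
  (forall x, horizon T x -> et x = eta x) ->
  (forall x, horizon T x ->
     F x = f x /\ F' x = Derive_on (horizon T) f x) ->
  J theta eta T f = RInt (revenue_rate th et F F') 0 T.
Proof.
intros e1 e2 e3; apply (RInt_ext (V := R_CompleteNormedModule)).
rewrite Rmin_left, Rmax_right by lra; intros x hx.
assert (h : horizon T x) by (unfold horizon; lra).
unfold revenue_rate; destruct (e3 x h) as [-> ->].
now rewrite e1, e2.
Qed.

End Extension.

(** * Transfer to [[0,T]] and absence of manipulation *)

Theorem proposition15 (T : R) (theta eta : R -> R)
  (hT : 0 < T)
  (theta_pos : forall t, horizon T t -> 0 < theta t)
  (eta_pos : forall t, horizon T t -> 0 < eta t)
  (theta_C1 : C1_on (horizon T) theta)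
  (eta_C1 : C1_on (horizon T) eta)
  (theta_incr : forall s t, horizon T s -> horizon T t -> s < t ->
     theta s < theta t)
  (eta_decr : forall s t, horizon T s -> horizon T t -> s < t ->
     eta t < eta s)
  (hopt : forall Q, 0 < Q -> unique_optimal_execution theta eta T Q) :
  (forall Q zeta, 0 < Q -> optimal_execution theta eta T Q zeta ->
     sell_only T zeta) /\
  ~ transaction_triggered_price_manipulation theta eta T /\
  ~ price_manipulation theta eta T.
Proof.
destruct (C1_extension T hT theta theta_C1) as [th [th' [hth eth]]].
destruct (C1_extension T hT eta eta_C1) as [et [et' [het eet]]].
assert (eth0 : forall x, horizon T x -> th x = theta x) by now apply eth.
assert (eet0 : forall x, horizon T x -> et x = eta x) by now apply eet.
assert (et_pos : forall t, 0 <= t <= T -> 0 < et t).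
{ intros t ht; rewrite eet0 by exact ht; now apply eta_pos. }
assert (th'_nonneg : forall t, 0 < t < T -> 0 <= th' t).
{ intros t ht; apply (derive_nonneg_of_increasing th th' 0 T); auto.
  intros a b ha hab hb.
  assert (horizon T a /\ horizon T b) as [Ha Hb] by (unfold horizon; lra).
  rewrite !eth0 by assumption; now apply theta_incr. }
assert (h0 : horizon T 0) by (unfold horizon; lra).
assert (hTT : horizon T T) by (unfold horizon; lra).
assert (sell : forall Q zeta, 0 < Q -> optimal_execution theta eta T Q zeta ->
  sell_only T zeta).
{ intros Q zeta hQ [[c2 [zQ z0]] best].
  destruct (C2_extension T hT zeta c2) as [z [z' [z'' [hz [hz' ez]]]]].
  intros t ht; destruct (ez t ht) as [_ <-].
  apply (optimal_nonincreasing T th th' et et' hT hth het th'_nonneg et_pos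
           z z' z'' hz hz'); [| | |exact ht].
  - rewrite (proj1 (ez T hTT)); exact z0.
  (* The perturbed extension is itself an admissible strategy, so optimality of [zeta] applies to
     it. *)
  - intros h h' h'' hh hh' hz0 hzT eps.
    rewrite <- (J_extension T hT theta eta th et zeta z z') by assumption.
    pose proof (C1_pair_plus _ _ _ _ hz (C1_pair_scal eps _ _ hh)) as hp.
    pose proof (C1_pair_plus _ _ _ _ hz' (C1_pair_scal eps _ _ hh')) as hp'.
    rewrite <- (J_extension T hT theta eta th et (fun t => z t + eps * h t)
                 (fun t => z t + eps * h t) (fun t => z' t + eps * h' t));
      auto.
    + apply best; split; [exact (C2_on_C1_pair T hT _ _ _ hp hp')|].
      rewrite hz0, hzT, (proj1 (ez 0 h0)), (proj1 (ez T hTT)); lra.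
    + intros x hx; split; [reflexivity|].
      symmetry.
      now apply (Derive_on_C1_pair T hT _ _ _ hp (fun _ _ => eq_refl)).
  - rewrite (proj1 (ez 0 h0)), zQ; exact hQ. }
split; [exact sell|split].
(* The maximizer sells only, so its value is one of those under the supremum, and no strategy
   exceeds it. *)
- intros [Q [xi [hQ [hxi lt]]]].
  destruct (hopt Q hQ) as [zeta [hz _]].
  apply (Rbar_lt_not_le _ _ lt).
  apply Rbar_le_trans with (Finite (J theta eta T zeta));
    [apply hz, hxi|].
  apply (proj1 (Lub_Rbar_correct _)).
  exists zeta; split; [apply hz|split; [now apply (sell Q)|reflexivity]].
(* A positive value contradicts the upper bound [- (th 0 * z 0 ^ 2) / 2], which is not positive. *)
- intros [Q [xi [hQ [[c2 [xQ xT]] pos]]]].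
  destruct (C2_extension T hT xi c2) as [z [z' [z'' [hz [_ ez]]]]].
  rewrite (J_extension T hT theta eta th et xi z z') in pos by assumption.
  assert (zT : z T = 0) by (rewrite (proj1 (ez T hTT)); exact xT).
  pose proof (revenue_upper_bound T th th' et et' hT hth het th'_nonneg et_pos
                z z' hz zT) as ub.
  assert (0 <= th 0 * z 0 ^ 2).
  { apply Rmult_le_pos; [|apply pow2_ge_0].
    rewrite eth0 by exact h0; now apply Rlt_le, theta_pos. }
  lra.
Qed.
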